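(* Let $n\ge 2$ be a natural number, let $R(x_1,\dots,x_n)=\sum_{i=1}^{n}a_i x_i$ (with $a_1,\dots,a_n$ nonzero integers) be a polynomial that is partition regular on $\mathbb{N}$, and let $m$ be a positive natural number. Then, for every $F_1,\dots,F_n\subseteq\{1,\dots,m\}$ (with the request that, when $n=2$, $F_1\cup F_2\neq\emptyset$), the polynomial $$P(x_1,\dots,x_n,y_1,\dots,y_m)=\sum_{i=1}^{n}a_i\,x_i\,Q_{F_i}(y_1,\dots,y_m)$$ is injectively partition regular on $\mathbb{N}$.
   Context: $\mathbb{N}=\{1,2,3,\dots\}$. The variables $x_1,\dots,x_n,y_1,\dots,y_m$ are mutually distinct. For $F\subseteq\{1,\dots,m\}$, $Q_F(y_1,\dots,y_m)$ denotes the monomial $\prod_{j\in F}y_j$ if $F\neq\emptyset$, and $Q_\emptyset(y_1,\dots,y_m)=1$. A polynomial $P(x_1,\dots,x_n)$ with integer coefficients is partition regular on $\mathbb{N}$ if for every natural number $r$ and every partition $\mathbb{N}=\bigcup_{i=1}^{r}A_i$ there are an index $j\le r$ and natural numbers $b_1,\dots,b_n\in A_j$ such that $P(b_1,\dots,b_n)=0$. It is injectively partition regular on $\mathbb{N}$ if for every natural number $r$ and every such partition there are an index $j\le r$ and mutually distinct natural numbers $b_1,\dots,b_n\in A_j$ such that $P(b_1,\dots,b_n)=0$.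
   Formalization: For n = 2 it is additionally required that F_1 ≠ F_2; the printed claim fails otherwise, since R partition regular gives a_1 + a_2 = 0, and with F_1 = F_2 (e.g. P = x_1y_1 − x_2y_1) P = 0 forces x_1 = x_2. *)

(* Defs.v *)
From mathcomp Require Import all_boot all_order all_algebra.
From mathcomp Require Import mpoly.

Set Implicit Arguments.
Unset Strict Implicit.
Unset Printing Implicit Defensive.

Import GRing.Theory.
Local Open Scope ring_scope.

(* The natural numbers start at 1, hence the conditions [(0 < _)%N]. Classes   *)
(* are arbitrary Prop-valued sets and, as for finite colourings, may be empty. *)
Definition is_partition (r : nat) (A : 'I_r -> nat -> Prop) : Prop :=
  (forall k : nat, (0 < k)%N <-> exists i : 'I_r, A i k) /\
  (forall (i j : 'I_r) (k : nat), A i k -> A j k -> i = j).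

Definition partition_regular (n : nat) (P : {mpoly int[n]}) : Prop :=
  forall (r : nat) (A : 'I_r -> nat -> Prop),
    (0 < r)%N -> is_partition A ->
    exists (j : 'I_r) (b : 'I_n -> nat),
      (forall i, A j (b i)) /\ P.@[fun i => (b i)%:Z] = 0.

Definition injectively_partition_regular (n : nat) (P : {mpoly int[n]}) : Prop :=
  forall (r : nat) (A : 'I_r -> nat -> Prop),
    (0 < r)%N -> is_partition A ->
    exists (j : 'I_r) (b : 'I_n -> nat),
      [/\ injective b, forall i, A j (b i) & P.@[fun i => (b i)%:Z] = 0].

Definition linear_poly (n : nat) (a : 'I_n -> int) : {mpoly int[n]} :=
  \sum_(i < n) a i *: 'X_i.

(* In int[n + m], the first n indeterminates are x_1, ..., x_n and the last m  *)
(* are y_1, ..., y_m.                                                          *)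
Definition x_var (n m : nat) (i : 'I_n) : {mpoly int[n + m]} := 'X_(lshift m i).

Definition y_var (n m : nat) (j : 'I_m) : {mpoly int[n + m]} := 'X_(rshift n j).

Definition Q (n m : nat) (F : {set 'I_m}) : {mpoly int[n + m]} :=
  \prod_(j in F) y_var n j.

Definition twisted_poly (n m : nat) (a : 'I_n -> int) (F : 'I_n -> {set 'I_m}) :
    {mpoly int[n + m]} :=
  \sum_(i < n) a i *: (x_var m i * Q n (F i)).

(* Main.v *)
Require Import Defs.
From mathcomp Require Import all_boot all_order all_algebra.
From mathcomp Require Import mpoly zify ring lra.
From Stdlib Require Import Classical ClassicalEpsilon.

(** The form [R] is homogeneous, so a solution [b] of [R(b) = 0] may be rescaled
    at will. If [b] solves [R] and [x_i = w_i b_i], where [w_i] is, up to a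
    factor common to all [i], the product of the [y_j] with [j] outside [F_i],
    then every term [a_i x_i Q_(F_i)(y)] is [a_i b_i] times one and the same
    number, and [P(x, y) = 0]. What has to be arranged is that all the [x_i] and
    [y_j] get the same colour and are distinct.

    Colours. Solutions [b^0, b^1, ...] are chosen one after the other,
    together with the marked entries [g_k = b^k_(i0)]. Since the colouring
    [s |-> (chi (w s))_(w <= M)] is again finite, [b^k] can be taken
    monochromatic for it ([interchangeable_zero]): as long as [w <= M], the
    entries of [b^k] are interchangeable in the colour of [w b^k_i].
    Colouring a finite set [K] of indices by the colour of the product of the
    [g_l], [l] in [K], the finite unions theorem ([finite_unions]) yields
    [m + 1] disjoint blocks all of whose unions have the same colour. The block
    that contains the largest index [t] serves for the [x_i]; each of the [m]
    other blocks gives one [y_j], the product of its [g_l]. Then [x_i] is obtained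
    from the product over a union of blocks containing [t] by replacing the
    factor [g_t] by [b^t_i], which does not change its colour.

    Distinctness. Taking [b^k] larger than all products of earlier [g_l] makes
    products over different index sets differ, even by a prescribed factor
    ([prod_lacunary]), and makes the [y_j] smaller than the [x_i]. That the
    [x_i] differ from each other requires [q b^t_i <> q' b^t_k] for bounded [q] and
    [q']. For [n = 2] the ratio of [b_1] and [b_2] is bounded by the coefficients,
    and the prescribed factor is enough. For [n >= 3] ([regular_separated]) one
    perturbs: finitely many numbers [s] suffice for monochromatic solutions
    ([regular_compact]), van der Waerden's theorem gives [c] and [e] such that the
    colour of [s (c + e j)] depends only on [s] for all [s] and [j] in a large range,
    and therefore [c b + D u] is monochromatic together with [b], for a suitable
    multiple [D] of [e]; here [u] is an integral solution of [R(u) = 0] that is off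
    finitely many hyperplanes [q u_i = q' u_k]. *)

Set Implicit Arguments.
Unset Strict Implicit.
Unset Printing Implicit Defensive.

Import Order.TTheory GRing.Theory Num.Theory.

(** * Preliminaries *)

Lemma dependent_function (A B : Type) (R : A -> B -> Prop) :
  (forall x, exists y, R x y) -> exists f : A -> B, forall x, R x (f x).
Proof.
move=> H; exists (fun x => proj1_sig (constructive_indefinite_description _ (H x))).
by move=> x; case: (constructive_indefinite_description _ _).
Qed.

Lemma pigeonhole (C : finType) (f : nat -> C) :
  exists s t, [/\ s < t, t <= #|C| & f s = f t].
Proof.
pose g (i : 'I_#|C|.+1) := f i.
case: (boolP (injectiveb g)) => [/injectiveP/leq_card|/injectivePn[i [j neq_ij eq_g]]].
  by rewrite card_ord ltnn.
case: (ltngtP i j) => [lt|lt|/val_inj e].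
- by exists i, j; split=> //; rewrite -ltnS.
- by exists j, i; split=> //; rewrite -ltnS.
- by rewrite e eqxx in neq_ij.
Qed.

(** * Compactness *)

Definition regular (n : nat) (E : ('I_n -> nat) -> Prop) : Prop :=
  forall (C : finType) (chi : nat -> C),
    exists b, E b /\ forall i j, chi (b i) = chi (b j).

(** By Koenig's lemma on the tree of finite colour sequences: those that infinitely
    many of the [X N] begin with can be extended within the same class. *)
Lemma coloring_limit (C : finType) (X : nat -> nat -> C) :
  exists chi : nat -> C, forall K M : nat,
    exists N, M <= N /\ forall k, k < K -> X N k = chi k.
Proof.
pose recurs (p : seq C) := forall M, exists N,
  M <= N /\ forall k, k < size p -> X N k = nth (X 0 0) p k.
have ext p : exists c, recurs p -> recurs (rcons p c).
  apply: NNPP => noc.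
  have recp : recurs p.
    by apply: NNPP => nrec; apply: noc; exists (X 0 0) => /nrec.
  have bound c : exists M, forall N, M <= N ->
      ~ forall k, k < size (rcons p c) -> X N k = nth (X 0 0) (rcons p c) k.
    apply: NNPP => nb; apply: noc; exists c => _ M.
    apply: NNPP => nN; apply: nb; exists M => N leMN H.
    by apply: nN; exists N.
  have [bd Hbd] := dependent_function bound.
  have [N [leN agree]] := recp (\max_c bd c).
  apply: (Hbd (X N (size p)) N); first by apply: leq_trans leN; apply: leq_bigmax.
  move=> k; rewrite size_rcons ltnS leq_eqVlt nth_rcons => /orP[/eqP->|lt_k].
    by rewrite ltnn eqxx.
  by rewrite lt_k agree.
have [F HF] := dependent_function ext.
pose pre k := iter k (fun p => rcons p (F p)) [::].
have rec_pre k : recurs (pre k).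
  by elim: k => [M|k IH]; [exists M | exact: HF].
have size_pre k : size (pre k) = k by elim: k => //= k IH; rewrite size_rcons IH.
have nth_pre K k : k < K -> nth (X 0 0) (pre K) k = F (pre k).
  elim: K => // K IH; rewrite ltnS leq_eqVlt /= nth_rcons size_pre.
  by case/orP=> [/eqP->|lt]; rewrite ?ltnn ?eqxx // lt IH.
exists (fun k => F (pre k)) => K M.
have [N [leMN agree]] := rec_pre K M; exists N; split=> // k ltk.
by rewrite agree ?size_pre // nth_pre.
Qed.

(** Colourings without a monochromatic witness below [N], for every [N], would
    have a limit; a witness for the limit is finite, hence a witness for
    some late term of the sequence. *)
Lemma regular_compact n (E : ('I_n -> nat) -> Prop) (C : finType) :
  regular E -> exists N, forall chi : nat -> C,
    exists b, [/\ E b, forall i, b i <= N & forall i j, chi (b i) = chi (b j)].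
Proof.
move=> regE; apply: NNPP => noN.
have bad N : exists chi : nat -> C, ~ exists b,
    [/\ E b, forall i, b i <= N & forall i j, chi (b i) = chi (b j)].
  apply: NNPP => H; apply: noN; exists N => chi.
  by apply: NNPP => H'; apply: H; exists chi.
have [X HX] := dependent_function bad.
have [chi Hchi] := coloring_limit X.
have [b [Eb mono]] := regE _ chi.
have [N [leN agree]] := Hchi (\max_i b i).+1 (\max_i b i).
have le_max i : b i <= \max_i b i by apply: leq_bigmax.
apply: (HX N); exists b; split=> // [i|i j]; first exact: leq_trans leN.
by rewrite !agree ?ltnS.
Qed.

(** * Van der Waerden's theorem *)

(** The case of Graham and Rothschild's argument that is needed for the next
    length: the points [a + l D s], [s <= k], are such that the progression from the
    [s]-th to the [t]-th of them in [l] steps keeps the colour of its start,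
    except perhaps at its end. The chain is lengthened by one point by colouring [x]
    with the whole pattern of [chi] on the block that starts at [x]: if the blocks
    starting at [x + j e] look alike for [j < l], a chain in the first of them may be
    continued with the additional gap [e]. *)
Lemma van_der_Waerden_chain l :
  (forall C : finType, exists N, forall chi : nat -> C, exists a d,
     [/\ 0 < d, a <= N, d <= N & forall j, j < l -> chi (a + j * d) = chi a]) ->
  forall k (C : finType), exists N, forall chi : nat -> C,
    exists a, exists D : nat -> nat,
    [/\ forall s, s < k -> D s < D s.+1, a <= N, D k <= N &
        forall s t j, s <= t -> t <= k -> j < l ->
          chi (a + l * D s + j * (D t - D s)) = chi (a + l * D s)].
Proof.
move=> vdW; elim=> [|k IH] C.
  exists 0 => chi; exists 0, (fun=> 0); split=> // s t j _ _ _.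
  by rewrite subnn !muln0 addn0.
have [N0 HN0] := IH C.
pose W := l.+1 * N0.
have [N1 HN1] := vdW {ffun 'I_W.+1 -> C}.
exists (N0 + N1) => chi.
have [x [e [e_gt0 le_x le_e block]]] :=
  HN1 (fun x => [ffun y : 'I_W.+1 => chi (x + y)]).
have {}block y j : y <= W -> j < l -> chi (x + j * e + y) = chi (x + y).
  move=> leyW ltj; move/ffunP/(_ (Ordinal (leyW : y < W.+1))): (block j ltj).
  by rewrite !ffunE.
have [a [D [D_incr le_a le_D chain]]] := HN0 (fun y => chi (x + y)).
have D_mono s t : s <= t -> t <= k -> D s <= D t.
  move=> le_st; rewrite -(subnKC le_st).
  elim: (t - s) => [|d IHd] le_k; first by rewrite addn0.
  rewrite addnS in le_k *; apply: leq_trans (IHd (ltnW le_k)) _.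
  exact/ltnW/D_incr.
exists (x + a), (fun s => if s <= k then D s else D k + e).
split=> [s|||s t j]; [|lia| |].
- rewrite ltnS => /= le_s; rewrite le_s; case: (ltnP s k) => [|ge_s]; first exact: D_incr.
  by have -> : s = k; lia.
- by rewrite ltnn; lia.
rewrite leq_eqVlt => /orP[/eqP->|lt_st] le_t ltj.
  by rewrite subnn muln0 addn0.
have le_s : s <= k by lia.
rewrite le_s; case: (leqP t k) => [le_tk|gt_tk].
  by have := chain s t j (ltnW lt_st) le_tk ltj; rewrite !addnA.
have leD := D_mono _ _ le_s (leqnn k).
have := chain s k j le_s (leqnn k) ltj; rewrite !addnA => <-.
have -> : x + a + l * D s + j * (D k - D s)
  = x + (a + l * D s + j * (D k - D s)) by rewrite !addnA.
rewrite -(block _ j) //; last first.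
  rewrite /W.
  have : j * (D k - D s) <= l * (D k - D s) by rewrite leq_mul2r ltnW ?orbT.
  have : l * D k <= l * N0 by rewrite leq_mul2l le_D orbT.
  have : l * D s <= l * D k by rewrite leq_mul2l leD orbT.
  rewrite mulnBr mulSn; lia.
have -> : D k + e - D s = D k - D s + e by lia.
by congr chi; rewrite mulnDr; lia.
Qed.

(** In a chain with more points than colours, two points have the same colour; the
    progression that joins them is then monochromatic up to and including its
    end. *)
Theorem van_der_Waerden l (C : finType) :
  exists N, forall chi : nat -> C, exists a d,
    [/\ 0 < d, a <= N, d <= N & forall j, j < l -> chi (a + j * d) = chi a].
Proof.
elim: l C => [|l IH] C; first by exists 1 => chi; exists 0, 1.
have [N HN] := van_der_Waerden_chain IH #|C| C.
exists (l.+1 * N) => chi; have [a [D [D_incr le_a le_D chain]]] := HN chi.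
have [s [t [lt_st le_t eq_st]]] := pigeonhole (fun s => chi (a + l * D s)).
have D_lt p q : p < q -> q <= #|C| -> D p < D q.
  move=> lt_pq; rewrite -(subnKC lt_pq).
  elim: (q - p.+1) => [|d IHd] le_k; first by rewrite addn0 in le_k *; apply: D_incr.
  rewrite addnS in le_k *; apply: leq_trans (IHd (ltnW le_k)) _.
  exact/ltnW/D_incr.
have lt_D := D_lt _ _ lt_st le_t.
have le_Dt : D t <= N.
  move: le_t; rewrite leq_eqVlt => /orP[/eqP->//|lt].
  by apply: leq_trans (ltnW (D_lt _ _ lt _)) le_D.
exists (a + l * D s), (D t - D s); split; first by rewrite subn_gt0.
- have : l * D s <= l * N by rewrite leq_mul2l; apply/orP; right; lia.
  by rewrite mulSn; lia.
- by rewrite mulSn; lia.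
move=> j; rewrite ltnS leq_eqVlt => /orP[/eqP->|ltj].
  by rewrite -addnA -mulnDr subnKC ?(ltnW lt_D).
exact: chain (ltnW lt_st) le_t ltj.
Qed.

(** * The finite unions theorem *)

(** A family of [m] disjoint subsets of ['I_N] is encoded by the map that sends an
    element to the index of its block, if any. Disjointness is built in, and
    forming unions of unions becomes composition of such maps. *)
Definition block_union (N m : nat) (phi : 'I_N -> option 'I_m) (I : {set 'I_m}) :
    {set 'I_N} :=
  [set t | oapp (mem I) false (phi t)].

Definition blocks_nonempty (N m : nat) (phi : 'I_N -> option 'I_m) : Prop :=
  forall i, exists t, phi t = Some i.

(** Hilbert's cube lemma for sets: block [0] is the base, the others are the
    directions. For one more direction, the colour patterns [A |-> chi (A u E)], where
    [E] runs through a long increasing chain of sets of fresh elements, cannot all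
    differ: if [E_s] and [E_t] give the same pattern, [E_s] joins the base and
    [E_t] minus [E_s] is the new direction. *)
Lemma Hilbert_cube d (C : finType) :
  exists N, forall chi : {set 'I_N} -> C, exists phi : 'I_N -> option 'I_d.+1,
    blocks_nonempty phi /\
    exists c, forall I : {set 'I_d.+1}, ord0 \in I -> chi (block_union phi I) = c.
Proof.
elim: d C => [|d IH] C.
  exists 1 => chi; exists (fun=> Some ord0); split=> [i|].
    by exists ord0; rewrite (ord1 i).
  exists (chi setT) => I I0; congr chi; apply/setP=> t.
  by rewrite !inE /= I0.
have [N HN] := IH C.
pose q := #|{ffun {set 'I_N} -> C}|.
exists (N + q) => chi.
pose glue (A : {set 'I_N}) (s : nat) : {set 'I_(N + q)} :=
  [set t | match split t with inl u => u \in A | inr k => k < s end].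
have [s [t [lt_st le_tq eq_st]]] :=
  pigeonhole (fun s => [ffun A : {set 'I_N} => chi (glue A s)]).
have {}eq_st A : chi (glue A s) = chi (glue A t).
  by move/ffunP/(_ A): eq_st; rewrite !ffunE.
have [phi [phi_surj [c Hc]]] := HN (fun A => chi (glue A s)).
exists (fun u => match split u with
  | inl v => omap (widen_ord (leqnSn _)) (phi v)
  | inr k => if k < s then Some ord0 else if k < t then Some ord_max else None end).
split=> [i|].
  case: (unliftP ord_max i) => [j ->|->].
    have [v Hv] := phi_surj j; exists (lshift q v).
    rewrite (unsplitK (inl v)) Hv /=; congr Some; apply: val_inj => /=.
    by rewrite /bump leqNgt ltn_ord.
  have lt_sq : s < q by apply: leq_trans le_tq.
  exists (rshift N (Ordinal lt_sq)); rewrite (unsplitK (inr _)) /=.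
  by rewrite ltnn lt_st.
exists c => I I0.
pose J := [set j | widen_ord (leqnSn d.+1) j \in I].
have J0 : ord0 \in J by rewrite inE (_ : widen_ord _ _ = ord0) //; apply: val_inj.
rewrite -(Hc J J0).
case: (boolP (ord_max \in I)) => Imax; first rewrite eq_st;
  congr chi; apply/setP=> u; rewrite !inE; case: (split u) => [v|k].
- by rewrite inE; case: (phi v) => //= j; rewrite inE.
- case: ltnP => [lt|ge] /=; first by rewrite I0; apply/esym; apply: ltn_trans lt_st.
  by case: ltnP => //=; rewrite Imax.
- by rewrite inE; case: (phi v) => //= j; rewrite inE.
- case: ltnP => [lt|ge] /=; first by rewrite I0.
  by case: ltnP => //= _; rewrite (negbTE Imax).
Qed.

(** The base of a cube has the same colour with or without any union of
    directions. Making it the first block and looking for the remaining blocks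
    among the unions of directions, the colour of a union depends only on the
    first block that takes part in it. *)
Lemma finite_unions_by_first m (C : finType) :
  exists N, forall chi : {set 'I_N} -> C, exists phi : 'I_N -> option 'I_m,
    blocks_nonempty phi /\
    exists c : 'I_m -> C, forall (I : {set 'I_m}) i, i \in I ->
      (forall j, j \in I -> i <= j) -> chi (block_union phi I) = c i.
Proof.
elim: m C => [|m IH] C.
  exists 0 => chi; exists (fun=> None); split; first by case.
  by exists (fun=> chi set0) => I; case.
have [N0 HN0] := IH C; have [N HN] := Hilbert_cube N0 C.
exists N => chi; have [phi [phi_surj [c0 Hc0]]] := HN chi.
have [psi [psi_surj [c Hc]]] :=
  HN0 (fun J => chi (block_union phi (lift ord0 @: J))).
pose rho (i : 'I_N0.+1) :=
  if unlift ord0 i is Some j then omap (lift ord0) (psi j) else Some ord0.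
exists (fun t => obind rho (phi t)); split=> [i|].
  case: (unliftP ord0 i) => [j ->|->].
    have [k Hk] := psi_surj j; have [t Ht] := phi_surj (lift ord0 k).
    by exists t; rewrite Ht /= /rho liftK Hk.
  by have [t Ht] := phi_surj ord0; exists t; rewrite Ht /= /rho unlift_none.
have unionE I : block_union (fun t => obind rho (phi t)) I
    = block_union phi [set k | oapp (mem I) false (rho k)].
  by apply/setP=> t; rewrite !inE; case: (phi t) => //= k; rewrite inE.
exists (fun i => if unlift ord0 i is Some j then c j else c0) => I i Ii minI.
rewrite unionE; case: (unliftP ord0 i) Ii minI => [j ->|->] Ii minI; last first.
  by apply: Hc0; rewrite inE /rho unlift_none.
have I0 : ord0 \notin I by apply/negP => /minI.
rewrite -(Hc [set j | lift ord0 j \in I] j) ?inE //; last first.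
  by move=> k; rewrite inE => /minI.
congr (chi (block_union phi _)); apply/setP=> k; rewrite inE /rho.
case: (unliftP ord0 k) => [l ->|->]; last first.
  rewrite /= (negbTE I0); apply/esym/negP=> /imsetP[x _] /(congr1 val).
  by [].
rewrite (mem_imset _ _ (@lift_inj _ ord0)) inE.
by case: (psi l) => //= x; rewrite inE.
Qed.

(** Among sufficiently many blocks as above, [m] have the same colour. *)
Theorem finite_unions m (C : finType) :
  exists N, forall chi : {set 'I_N} -> C, exists phi : 'I_N -> option 'I_m,
    blocks_nonempty phi /\
    exists c, forall I, I != set0 -> chi (block_union phi I) = c.
Proof.
have [N HN] := finite_unions_by_first (#|C| * m).+1 C.
exists N => chi; have [phi [phi_surj [col Hcol]]] := HN chi.
have [c le_m] : exists c, m <= #|[set i | col i == c]|.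
  apply/existsP; apply: contraT; rewrite negb_exists => /forallP small.
  have : \sum_c #|[set i | col i == c]| <= #|C| * m.
    have small_sum : \sum_c #|[set i | col i == c]| <= \sum_(c : C) m.
      by apply: leq_sum => c _; apply: ltnW; rewrite ltnNge.
    by apply: leq_trans small_sum _; rewrite sum_nat_const.
  suff -> : \sum_c #|[set i | col i == c]| = #|'I_(#|C| * m).+1|.
    by rewrite card_ord ltnn.
  rewrite -[RHS]sum1_card (partition_big col predT) //=.
  by apply: eq_bigr => c _; rewrite -[LHS]sum1_card; apply: eq_bigl => i; rewrite inE.
pose e (i : 'I_m) : 'I_(#|C| * m).+1 := enum_val (widen_ord le_m i).
have e_inj : injective e.
  by move=> i j /enum_val_inj/(congr1 val) eq_ij; apply: val_inj.
have col_e i : col (e i) = c.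
  by have := enum_valP (widen_ord le_m i); rewrite inE => /eqP.
pose rho k := [pick i | e i == k].
have rhoE i : rho (e i) = Some i.
  rewrite /rho; case: pickP => [j /eqP/e_inj->//|/(_ i)]; by rewrite eqxx.
exists (fun t => obind rho (phi t)); split=> [i|].
  by have [t Ht] := phi_surj (e i); exists t; rewrite Ht /= rhoE.
exists c => I /set0Pn[i0 Ii0].
have -> : block_union (fun t => obind rho (phi t)) I = block_union phi (e @: I).
  apply/setP=> t; rewrite !inE; case: (phi t) => //= k.
  apply/idP/imsetP => [|[i Ii ->]]; last by rewrite rhoE.
  by rewrite /rho; case: pickP => //= i /eqP <- Ii; exists i.
have e0 : e i0 \in e @: I by apply: imset_f.
case: (arg_minnP (P := mem (e @: I)) (fun k => val k) e0) => k kI mink.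
rewrite (Hcol _ k) //; by case/imsetP: kI => i _ ->.
Qed.

Local Open Scope ring_scope.

(** * Integral zeros of the linear form off finitely many hyperplanes *)

Lemma exists_nat_nonroot (p : {poly int}) : p != 0 -> exists B : nat, p.[B%:Z] != 0.
Proof.
move=> p_neq0; case: (boolP (all (root p) (map Posz (iota 0 (size p))))) => [roots|].
  have := max_poly_roots p_neq0 roots.
  rewrite map_inj_uniq ?iota_uniq; last by move=> x y [].
  by rewrite size_map size_iota ltnn => /(_ isT).
by case/allPn => z /mapP[B _ ->] nroot; exists B.
Qed.

(** Project the moment curve [(1, B, ..., B^(n-1))] orthogonally onto the kernel
    of the form, and clear the denominator [S]. The difference of [q] times the
    [i]-th and [q'] times the [k]-th coordinate is a nonzero polynomial in
    [B], because for [n >= 3] no form [q u_i - q' u_k] vanishes on the kernel. All these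
    polynomials are nonzero at some common [B]. *)
Lemma generic_kernel_vector (n : nat) (a : 'I_n -> int) (M : nat) :
  (2 < n)%N -> (forall i, a i != 0) ->
  exists u : 'I_n -> int, \sum_i a i * u i = 0 /\
    forall i k q q', i != k -> (0 < q <= M)%N -> (0 < q' <= M)%N ->
      q%:Z * u i != q'%:Z * u k.
Proof.
move=> n_gt2 a_neq0.
pose S := \sum_i a i ^+ 2.
pose T : {poly int} := \sum_(j < n) a j *: 'X^j.
pose P (i : 'I_n) := S *: 'X^i - a i *: T.
have S_neq0 : S != 0.
  have i0 : 'I_n := Ordinal (ltn_trans (isT : (0 < 2)%N) n_gt2).
  have : 0 < S.
    rewrite /S (bigD1 i0) //= ltr_pwDl ?exprn_even_gt0 ?a_neq0 //.
    by apply: sumr_ge0 => i _; apply: sqr_ge0.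
  by rewrite lt0r => /andP[].
have coefT (j : 'I_n) : T`_j = a j.
  rewrite coef_sum (bigD1 j) //= coefZ coefXn eqxx mulr1 big1 ?addr0 // => k neq_kj.
  by rewrite coefZ coefXn eq_sym (inj_eq val_inj) (negbTE neq_kj) mulr0.
have coefP i (j : 'I_n) : (P i)`_j = S * (i == j)%:R - a i * a j.
  by rewrite coefB !coefZ coefXn coefT eq_sym (inj_eq val_inj).
pose D i k (q q' : nat) := q%:Z *: P i - q'%:Z *: P k.
have D_neq0 i k q q' : i != k -> (0 < q)%N -> D i k q q' != 0.
  move=> neq_ik q_gt0; apply/eqP=> D0.
  have coefD (j : 'I_n) : q%:Z * (S * (i == j)%:R - a i * a j)
      - q'%:Z * (S * (k == j)%:R - a k * a j) = 0.
    by rewrite -!coefP -!coefZ -coefB -/(D i k q q') D0 coef0.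
  (* If q a_i = q' a_k, the coefficient of X^i is q S. *)
  have [eq_a|neq_a] := eqVneq (q%:Z * a i) (q'%:Z * a k).
    have := coefD i; rewrite eqxx eq_sym (negbTE neq_ik) /=.
    have -> : q%:Z * (S * 1 - a i * a i) - q'%:Z * (S * 0 - a k * a i) =
      q%:Z * S - (q%:Z * a i - q'%:Z * a k) * a i by ring.
    rewrite eq_a subrr mul0r subr0 => /eqP.
    by rewrite mulf_eq0 (negbTE S_neq0) orbF; lia.
  (* Otherwise, look at X^j for a third index j. *)
  have [j /andP[neq_ij neq_kj]] : exists j : 'I_n, (i != j) && (k != j).
    apply/existsP; apply: contraT; rewrite negb_exists => /forallP covered.
    have : (#|'I_n| <= #|[set i; k]|)%N.
      apply/subset_leq_card/subsetP=> j _; have := covered j.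
      by rewrite negb_and !negbK !inE ![j == _]eq_sym.
    by rewrite card_ord cards2 neq_ik => le_n; move: n_gt2; rewrite ltnNge le_n.
  have := coefD j; rewrite (negbTE neq_ij) (negbTE neq_kj) /=.
  have -> : q%:Z * (S * 0 - a i * a j) - q'%:Z * (S * 0 - a k * a j) =
    (q'%:Z * a k - q%:Z * a i) * a j by ring.
  move=> /eqP; rewrite mulf_eq0 (negbTE (a_neq0 j)) orbF subr_eq0 eq_sym.
  by rewrite (negbTE neq_a).
pose prodD := \prod_(x : ('I_n * 'I_n) * ('I_M.+1 * 'I_M.+1)
  | (x.1.1 != x.1.2) && (0 < x.2.1)%N) D x.1.1 x.1.2 x.2.1 x.2.2.
have [B HB] : exists B : nat, prodD.[B%:Z] != 0.
  apply: exists_nat_nonroot; apply/prodf_neq0 => x /andP[? ?]; exact: D_neq0.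
exists (fun i => (P i).[B%:Z]); split.
  have TB : T.[B%:Z] = \sum_(j < n) a j * B%:Z ^+ j.
    by rewrite horner_sum; apply: eq_bigr => j _; rewrite hornerZ hornerXn.
  transitivity (S * T.[B%:Z] - S * T.[B%:Z]); last exact: subrr.
  rewrite {1}TB {2}/S mulr_sumr mulr_suml -sumrB.
  by apply: eq_bigr => i _; rewrite hornerD hornerN !hornerZ hornerXn; ring.
move=> i k q q' neq_ik /andP[q_gt0 le_q] /andP[q'_gt0 le_q'].
move: HB; rewrite /prodD horner_prod => /prodf_neq0.
move/(_ ((i, k), (Ordinal (le_q : (q < M.+1)%N), Ordinal (le_q' : (q' < M.+1)%N)))).
by rewrite /= neq_ik q_gt0 hornerD hornerN !hornerZ subr_eq0; apply.
Qed.

(** * Monochromatic zeros with separated entries *)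

Definition positive_zero (n : nat) (a : 'I_n -> int) (b : 'I_n -> nat) : Prop :=
  (forall i, (0 < b i)%N) /\ \sum_i a i * (b i)%:Z = 0.

Lemma partition_regular_regular (n : nat) (a : 'I_n -> int) :
  partition_regular (linear_poly a) -> regular (positive_zero a).
Proof.
move=> pr C chi.
have C_gt0 : (0 < #|C|)%N by apply/card_gt0P; exists (chi 0).
pose A (c : 'I_#|C|) k := (0 < k)%N /\ enum_rank (chi k) = c.
have partA : is_partition A.
  split=> [k|i j k [_ <-] [_ <-] //]; split=> [k0|[i []] //].
  by exists (enum_rank (chi k)).
have [c [b [Ab]]] := pr _ A C_gt0 partA.
rewrite /linear_poly raddf_sum /= => eq0; exists b; split; first split.
- by move=> i; case: (Ab i).
- by rewrite -[RHS]eq0; apply: eq_bigr => i _; rewrite mevalZ mevalXU.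
by move=> i j; apply: enum_rank_inj; case: (Ab i) (Ab j) => _ -> [_ ->].
Qed.

(** A monochromatic zero [b] is perturbed to [x = c b + e N! u], where [u] is a generic
    kernel vector. As [x_i = b_i (c + e (N! / b_i) u_i)] is [b_i] times a term
    of a progression centred at [c], the choice of the progression makes it as
    monochromatic as [b], provided that the possible [b_i] are bounded by a number
    [N] known in advance. *)
Lemma regular_separated (n : nat) (a : 'I_n -> int) (M : nat) :
  (2 < n)%N -> (forall i, a i != 0) -> regular (positive_zero a) ->
  regular (fun b => positive_zero a b /\
    forall i k q q', i != k -> (0 < q <= M)%N -> (0 < q' <= M)%N ->
      (q * b i != q' * b k)%N).
Proof.
move=> n_gt2 a_neq0 reg C chi.
have [u [u_ker u_sep]] := generic_kernel_vector M n_gt2 a_neq0.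
have [N HN] := regular_compact C reg.
pose U := (\max_i `|u i|)%N.
have le_U i : (`|u i| <= U)%N by apply: leq_bigmax.
(* Half the length of the progression: large enough for |u_i| N! <= T and, as
   c > T e, for e N! |q u_i - q' u_k| < c. *)
pose T := (N`! * (M * U).*2.+1 * U.+1)%N.
have [N1 HN1] := van_der_Waerden T.*2.+1 {ffun 'I_N.+1 -> C}.
have [z [e [e_gt0 _ _ AP]]] := HN1 (fun z => [ffun s : 'I_N.+1 => chi (s * z.+1)%N]).
(* Starting at z + 1 keeps the progression, hence x, positive. *)
have {}AP (s j : nat) : (s <= N)%N -> (j <= T.*2)%N ->
    chi (s * (z + j * e).+1)%N = chi (s * z.+1)%N.
  move=> le_s le_j; have := AP j; rewrite ltnS => /(_ le_j)/ffunP.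
  by move/(_ (Ordinal (le_s : (s < N.+1)%N))); rewrite !ffunE.
have [b [[b_gt0 b_zero] le_b mono]] := HN (fun s => chi (s * z.+1)%N).
pose c := (z + T * e).+1.
have dvd_b i : (b i %| N`!)%N by rewrite dvdn_fact // b_gt0 le_b.
have bounded i : (`|u i| * (N`! %/ b i) <= T)%N.
  apply: leq_trans (leq_mul (le_U i) (leq_div _ _)) _.
  by rewrite mulnC /T -mulnA leq_mul2l mulSn; apply/orP; right; lia.
pose step i : int := T%:Z + u i * (N`! %/ b i)%:Z.
have step_ge0 i : 0 <= step i <= (T.*2)%:Z.
  by rewrite /step; have := bounded i; rewrite -[X in (_ * X)%N]absz_nat -abszM; lia.
pose x i := (b i * (z + `|step i| * e).+1)%N.
have xE i : (x i)%:Z = c%:Z * (b i)%:Z + (e * N`!)%:Z * u i.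
  rewrite PoszM; have -> : (N`!)%:Z = (b i)%:Z * (N`! %/ b i)%:Z.
    by rewrite -PoszM mulnC divnK.
  have : (`|step i|%N)%:Z = step i by have := step_ge0 i; lia.
  rewrite /x /c; move: `|step i|%N => k; rewrite /step => Ek.
  by clearbody T; rewrite !(PoszM, PoszD, intS) Ek; ring.
exists x; split; last first.
  by move=> i j; rewrite /x !AP //; have := step_ge0 i; have := step_ge0 j; lia.
split; first split.
- by move=> i; rewrite muln_gt0 b_gt0.
- under eq_bigr do rewrite xE mulrDr !(mulrCA (a _)).
  by rewrite big_split -!mulr_sumr b_zero u_ker !mulr0.
move=> i k q q' neq_ik qM q'M; apply/eqP=> /(congr1 Posz).
clearbody x; rewrite !PoszM !xE.
(* The equation reads c A = - e N! D; its right side is nonzero and smaller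
   than c in absolute value. *)
set A := q%:Z * (b i)%:Z - q'%:Z * (b k)%:Z.
set D := q%:Z * u i - q'%:Z * u k.
have D_neq0 : D != 0 by rewrite subr_eq0 u_sep.
have le_D : (`|D| <= (M * U).*2)%N.
  apply: leq_trans (leqD_dist (q%:Z * u i) 0 (q'%:Z * u k)) _.
  rewrite subr0 sub0r abszN !abszM !absz_nat -addnn.
  by apply: leq_add; apply: leq_mul; rewrite ?le_U //; case/andP: qM q'M => _ ? /andP[].
move=> eq_x; have {eq_x} : c%:Z * A = - ((e * N`!)%N%:Z * D).
  by move: eq_x; rewrite /A /D; move: (e * N`!)%N => w; lra.
have c_large : (e * N`! * `|D| < c)%N.
  rewrite /c ltnS; apply: leq_trans (leq_addl _ _).
  rewrite [(T * e)%N]mulnC -mulnA leq_mul2l; apply/orP; right.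
  rewrite /T -mulnA leq_mul2l; apply/orP; right.
  by rewrite mulnS; lia.
move/(congr1 absz); rewrite abszN !abszM !absz_nat.
have [->|A_neq0] := eqVneq A 0.
  rewrite muln0 => /esym/eqP; rewrite !muln_eq0 absz_eq0 (negbTE D_neq0) orbF.
  by rewrite (negbTE (lt0n_neq0 (fact_gt0 N))) orbF; lia.
move=> eq_cA; move: c_large; rewrite -eq_cA ltnNge leq_pmulr //.
by rewrite absz_gt0.
Qed.

(** For [n = 2] the ratio of [b_0] and [b_1] is forced by the coefficients, so that
    [q b_i = q' b_k] cannot be excluded for all small [q] and [q']. It is excluded when
    [q] and [q'] differ by a factor [C] larger than that ratio. *)
Definition separated (n C M : nat) (b : 'I_n -> nat) : Prop :=
  forall i k q q', i != k -> (0 < q <= M)%N -> (0 < q' <= M)%N ->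
    (n = 2%N -> (C * q < q')%N \/ (C * q' < q)%N) -> (q * b i != q' * b k)%N.

Lemma binary_zero_ratio (a : 'I_2 -> int) (b : 'I_2 -> nat) i k :
  (forall i, a i != 0) -> positive_zero a b -> i != k ->
  (b i <= (\max_i `|a i|) * b k)%N.
Proof.
move=> a_neq0 [_ b_zero] neq_ik.
have : a i * (b i)%:Z = - (a k * (b k)%:Z).
  apply/eqP; rewrite -addr_eq0 -b_zero (bigD1 i) //=; apply/eqP; congr (_ + _).
  rewrite (bigD1 k) 1?eq_sym //= big1 ?addr0 // => j /andP[neq_ji neq_jk].
  have := ltn_ord i; have := ltn_ord j; have := ltn_ord k.
  by move: neq_ik neq_ji neq_jk; rewrite -!(inj_eq val_inj) /=; lia.
move/(congr1 absz); rewrite abszN !abszM !absz_nat => eq_ab.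
apply: leq_trans (_ : `|a i| * b i <= _)%N; first by rewrite leq_pmull ?absz_gt0.
by rewrite eq_ab leq_mul2r (leq_bigmax (F := fun i => `|a i|%N)) ?orbT.
Qed.

Lemma regular_separated_at_scale (n : nat) (a : 'I_n -> int) (M : nat) :
  (2 <= n)%N -> (forall i, a i != 0) -> regular (positive_zero a) ->
  regular (fun b => positive_zero a b /\ separated (\max_i `|a i|).+1 M b).
Proof.
rewrite leq_eqVlt => /orP[/eqP n2|n_gt2] a_neq0 reg D chi; last first.
  have [b [[b_zero b_sep] mono]] := regular_separated M n_gt2 a_neq0 reg chi.
  by exists b; do 2?split=> //; move=> i k q q' ? ? ? _; apply: b_sep.
have [b [b_zero mono]] := reg D chi; exists b; do 2?split=> //.
move=> i k q q' neq_ik /andP[q_gt0 _] /andP[q'_gt0 _] /(_ (esym n2)) gap.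
have b_gt0 := b_zero.1; subst n.
have le_ik := binary_zero_ratio a_neq0 b_zero neq_ik.
have := binary_zero_ratio a_neq0 b_zero; move/(_ k i); rewrite eq_sym => /(_ neq_ik).
move: (\max_i _)%N le_ik gap => c le_ik gap le_ki.
have bi := b_gt0 i; have bk := b_gt0 k.
have key q1 q2 b1 b2 : (0 < q1 -> 0 < b2 -> b1 <= c * b2 -> c.+1 * q1 < q2 ->
    q1 * b1 < q2 * b2)%N.
  move=> q1_gt0 b2_gt0 le_b lt_q; apply: leq_ltn_trans (_ : q1 * (c * b2) < _)%N.
    by rewrite leq_mul2l le_b orbT.
  by rewrite mulnA ltn_mul2r b2_gt0 /=; lia.
by case: gap => gap; apply/eqP; [have := key _ _ _ _ q_gt0 bk le_ik gap
  | have := key _ _ _ _ q'_gt0 bi le_ki gap]; lia.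
Qed.

Lemma separated_scale n C M s (b : 'I_n -> nat) :
  (0 < s)%N -> separated C M b -> separated C M (fun i => s * b i)%N.
Proof.
move=> s_gt0 sep i k q q' neq_ik qM q'M gap.
by rewrite ![(_ * (s * _))%N]mulnCA eqn_pmul2l // sep.
Qed.

Lemma positive_zero_scale n (a : 'I_n -> int) b s :
  (0 < s)%N -> positive_zero a b -> positive_zero a (fun i => s * b i)%N.
Proof.
move=> s_gt0 [b_gt0 b_zero]; split=> [i|]; first by rewrite muln_gt0 s_gt0 b_gt0.
under eq_bigr do rewrite PoszM mulrCA.
by rewrite -mulr_sumr b_zero mulr0.
Qed.

(** The witness is [(M + 1) b], which exceeds [M], where [b] is monochromatic for the
    finite colouring [s |-> (chi (w (M + 1) s))_(w <= M)]. *)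
Lemma interchangeable_zero (n : nat) (a : 'I_n -> int) (D : finType) (chi : nat -> D) :
  (2 <= n)%N -> (forall i, a i != 0) -> regular (positive_zero a) ->
  forall M, exists b : 'I_n -> nat,
    [/\ positive_zero a b, separated (\max_i `|a i|).+1 M b, forall i, (M < b i)%N &
        forall w i j, (w <= M)%N -> chi (w * b i)%N = chi (w * b j)%N].
Proof.
move=> n_ge2 a_neq0 reg M.
have [b [[b_zero b_sep] mono]] := regular_separated_at_scale M n_ge2 a_neq0 reg
  (fun s => [ffun w : 'I_M.+1 => chi (w * (M.+1 * s))%N]).
exists (fun i => M.+1 * b i)%N; split.
- exact: positive_zero_scale.
- exact: separated_scale.
- by move=> i; rewrite leq_pmulr // b_zero.1.
move=> w i j le_w; move/ffunP/(_ (Ordinal (le_w : (w < M.+1)%N))): (mono i j).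
by rewrite !ffunE.
Qed.

(** * Towers of zeros *)

(** The recursion makes [M t] the product of [C] and of all [g l], [l < t]. *)
Lemma prod_below (g M : nat -> nat) (C : nat) :
  M 0%N = C -> (forall k, M k.+1 = M k * g k)%N -> (forall k, M k < g k)%N ->
  forall (N : nat) (t : 'I_N) (A : {set 'I_N}),
  (forall l, l \in A -> l < t)%N -> (C * \prod_(l in A) g l <= M t)%N.
Proof.
move=> M0 MS lt_Mg N t A below.
have g_gt0 k : (0 < g k)%N by apply: leq_ltn_trans (lt_Mg k).
have -> : M t = (C * \prod_(l < t) g l)%N.
  elim: (t : nat) => [|k IH]; first by rewrite big_ord0 muln1.
  by rewrite MS IH big_ord_recr /= mulnA.
rewrite leq_mul2l (big_ord_widen N g (ltnW (ltn_ord t))); apply/orP; right.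
rewrite [leqRHS](bigID (mem A)) /=.
rewrite (eq_bigl (fun l : 'I_N => (l < t)%N && (l \in A))); last first.
  by move=> l; case: (boolP (l \in A)) => [/below->|]; rewrite ?andbF.
by rewrite leq_pmulr // prodn_gt0.
Qed.

(** Let [t] be the largest index that belongs to exactly one of the sets. Above [t]
    the products agree, and [g t] outweighs everything below [t]. *)
Lemma prod_lacunary (g M : nat -> nat) (C : nat) :
  M 0%N = C -> (forall k, M k.+1 = M k * g k)%N -> (forall k, M k < g k)%N ->
  forall (N : nat) (A B : {set 'I_N}), A != B ->
  (C * \prod_(l in A) g l < \prod_(l in B) g l)%N \/
  (C * \prod_(l in B) g l < \prod_(l in A) g l)%N.
Proof.
move=> M0 MS lt_Mg N A B neq_AB.
have g_gt0 k : (0 < g k)%N by apply: leq_ltn_trans (lt_Mg k).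
have [t0 Ht0] : exists t, (t \in A) != (t \in B).
  apply/existsP; apply: contraT; rewrite negb_exists => /forallP eq_AB.
  by case/eqP: neq_AB; apply/setP=> t; apply/eqP; rewrite -[_ == _]negbK eq_AB.
case: (arg_maxnP (P := fun t => (t \in A) != (t \in B)) (fun t => val t) Ht0).
move=> t Ht maxt.
wlog [tA tB] : A B Ht maxt {t0 Ht0 neq_AB} / t \notin A /\ t \in B => [wl|].
  case: (boolP (t \in A)) => tA; last first.
    by apply: wl => //; split=> //; move: Ht; rewrite (negbTE tA); case: (t \in B).
  apply/or_comm; apply: wl; first by rewrite eq_sym.
    by move=> k; rewrite eq_sym; apply: maxt.
  by split=> //; move: Ht; rewrite tA; case: (t \in B).
left; pose H := [set l : 'I_N | t < l]%N.
have eqU : A :&: H = B :&: H.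
  apply/setP=> l; rewrite !inE; case: (ltnP t l) => lt_tl; rewrite ?andbF // !andbT.
  by apply/eqP; apply: contraTT lt_tl => /maxt; rewrite -leqNgt.
rewrite (big_setID H) /= [X in (_ < X)%N](big_setID H) /= -eqU.
rewrite (bigD1 (P := mem (B :\: H)) t) /=; last by rewrite !inE ltnn.
rewrite mulnCA ltn_pmul2l ?prodn_gt0 //.
apply: leq_trans (_ : g t <= _)%N; last by rewrite leq_pmulr ?prodn_gt0.
apply: leq_ltn_trans (lt_Mg t); apply: (prod_below M0 MS lt_Mg) => l.
rewrite !inE -leqNgt; case/andP=> le_lt lA; rewrite ltn_neqAle le_lt andbT.
by apply: contraNneq tA => /val_inj <-.
Qed.

(** The scale [M k] bounds [C] times every product of marked entries of earlier
    zeros, so the [k]-th zero is interchangeable in front of all of these. *)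
Lemma zero_tower (n : nat) (a : 'I_n -> int) (i0 : 'I_n) (D : finType)
    (chi : nat -> D) :
  (2 <= n)%N -> (forall i, a i != 0) -> regular (positive_zero a) ->
  let C := (\max_i `|a i|).+1 in
  exists (b : nat -> 'I_n -> nat) (M : nat -> nat),
    [/\ M 0%N = C, forall k, M k.+1 = (M k * b k i0)%N & forall k,
      [/\ positive_zero a (b k), separated C (M k) (b k),
          forall i, (M k < b k i)%N &
          forall w i j, (w <= M k)%N -> chi (w * b k i)%N = chi (w * b k j)%N]].
Proof.
move=> n_ge2 a_neq0 reg C.
have [B HB] := dependent_function (interchangeable_zero chi n_ge2 a_neq0 reg).
pose M := fix M k := if k is k'.+1 then (M k' * B (M k') i0)%N else C.
by exists (fun k => B (M k)), M.
Qed.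

(** * The twisted equation *)

Lemma prod_block_union (N m : nat) (phi : 'I_N -> option 'I_m) (I : {set 'I_m})
    (g : nat -> nat) :
  (\prod_(l in block_union phi I) g l =
   \prod_(i in I) \prod_(l in block_union phi [set i]) g l)%N.
Proof.
rewrite (exchange_big_dep (mem (block_union phi I))) /=; last first.
  move=> i l iI; rewrite !inE; case: (phi l) => //= j.
  by rewrite inE => /eqP ->.
apply: eq_bigr => l; rewrite inE; case Hl: (phi l) => [i|] //= iI.
rewrite (big_pred1 i) // => j; rewrite inE Hl /= inE eq_sym.
by case: eqVneq => [->|]; rewrite ?iI ?andbF.
Qed.

Lemma last_block_element (N m : nat) (phi : 'I_N -> option 'I_m.+1) :
  blocks_nonempty phi ->
  exists t s, phi t = Some s /\
    forall l, l != t -> phi l != None -> (l < t)%N.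
Proof.
move=> phi_surj; have [l0 Hl0] := phi_surj ord0.
have l0_used : phi l0 != None by rewrite Hl0.
case: (arg_maxnP (P := fun l => phi l != None) (fun l => val l) l0_used).
move=> t; case Ht: (phi t) => [s|] //= _ maxt; exists t, s; split=> // l neq_lt /maxt.
by rewrite ltn_neqAle neq_lt.
Qed.

Lemma binary_family_injective (n : nat) (T : eqType) (f : 'I_n -> T) :
  n = 2%N -> (exists i j, f i != f j) -> injective f.
Proof.
move=> n2 [i1 [i2 neq_f]] i k eq_f; apply/eqP; apply: contraNT neq_f => neq_ik.
have all_ik i' : i' = i \/ i' = k.
  have := ltn_ord i'; have := ltn_ord i; have := ltn_ord k.
  have : (i : nat) <> k by move/val_inj => E; rewrite E eqxx in neq_ik.
  move=> ? ? ? ?; case: (eqVneq (i' : nat) i) => [/val_inj|neq]; [by left|right].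
  by apply: val_inj => /=; lia.
by apply/eqP; case: (all_ik i1) => ->; case: (all_ik i2) => ->.
Qed.

(** The solution described at the top: with [s] the block that contains the last
    index [t], the set [K i] consists of [s] without [t] and of the blocks of the [j]
    outside [F i], and [x i] is the product over [K i] times [b^t_i]. *)
Lemma monochromatic_twisted_zero (n m r : nat) (a : 'I_n -> int)
    (F : 'I_n -> {set 'I_m}) (chi : nat -> 'I_r) :
  (2 <= n)%N -> (forall i, a i != 0) -> regular (positive_zero a) ->
  (n = 2%N -> injective F) ->
  exists (c : 'I_r) (x : 'I_n -> nat) (y : 'I_m -> nat),
    [/\ injective x /\ injective y, forall i j, (y j < x i)%N,
        forall i, (0 < x i)%N /\ chi (x i) = c,
        forall j, (0 < y j)%N /\ chi (y j) = c &
        \sum_i a i * (x i * \prod_(j in F i) y j)%N%:Z = 0].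
Proof.
move=> n_ge2 a_neq0 reg F_inj.
have [b [M [M0 MS HB]]] := zero_tower (Ordinal (ltnW n_ge2)) chi n_ge2 a_neq0 reg.
move: (\max_i _).+1 (ltn0Sn (\max_i `|a i|)) M0 HB => C C_gt0 M0 HB.
pose g k := b k (Ordinal (ltnW n_ge2)).
have lt_Mg k : (M k < g k)%N by rewrite /g; case: (HB k).
have g_gt0 k : (0 < g k)%N by apply: leq_ltn_trans (lt_Mg k).
have below := prod_below (g := g) M0 MS lt_Mg.
have lacunary := prod_lacunary (g := g) M0 MS lt_Mg.
have [N HN] := finite_unions m.+1 'I_r.
have [phi [phi_surj [c Hc]]] := HN (fun K => chi (\prod_(l in K) g l)%N).
pose prodg (K : {set 'I_N}) := (\prod_(l in K) g l)%N.
have prodg_gt0 K : (0 < prodg K)%N by apply: prodn_gt0.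
have [t [s [Ht below_top]]] := last_block_element phi_surj.
pose Y j := block_union phi [set lift s j].
pose I i := s |: (lift s @: ~: F i).
pose K i := block_union phi (I i) :\ t.
have t_in i : t \in block_union phi (I i) by rewrite inE Ht /= setU11.
have wE i : (g t * prodg (K i) = prodg (block_union phi (I i)))%N.
  by rewrite /prodg [RHS](big_setD1 t).
have belowK i l : l \in K i -> (l < t)%N.
  by rewrite !inE => /andP[/below_top lt]; case E: (phi l) => // _; apply: lt; rewrite E.
have belowY j l : l \in Y j -> (l < t)%N.
  rewrite inE; case E: (phi l) => [k|] //=; rewrite inE => /eqP Ek.
  apply: below_top; rewrite ?E //; apply/eqP=> Elt.
  by move: Ht; rewrite -Elt E Ek => -[/eqP]; rewrite eq_sym (negbTE (neq_lift _ _)).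
have le_M (K' : {set 'I_N}) : (forall l, l \in K' -> l < t)%N -> (prodg K' <= M t)%N.
  by move/below; apply: leq_trans; rewrite leq_pmull.
pose x i := (prodg (K i) * b t i)%N.
pose y j := prodg (Y j).
have [[b_gt0 b_zero] b_sep lt_b same_color] := HB t.
have x_inj : injective x.
  move=> i k /eqP eq_x; apply/eqP; apply: contraTT eq_x => neq_ik.
  apply: b_sep => //; rewrite ?prodg_gt0 ?le_M //; try exact: belowK.
  move=> n2; apply: lacunary; apply/eqP=> eq_K.
  case/eqP: neq_ik; apply: (F_inj n2).
  apply/setP=> j; have [l Hl] := phi_surj (lift s j).
  have neq_lt : l != t.
    apply/eqP=> El; move: Ht; rewrite -El Hl => -[/eqP].
    by rewrite eq_sym (negbTE (neq_lift _ _)).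
  have inK i' : (l \in K i') = (j \notin F i').
    rewrite !inE neq_lt Hl /= /I !inE eq_sym (negbTE (neq_lift _ _)) /=.
    by rewrite (mem_imset _ _ (@lift_inj _ s)) inE.
  by apply: negb_inj; rewrite -!inK eq_K.
have y_inj : injective y.
  move=> j k eq_y; apply/eqP; apply: contraPT (erefl (y j)) => neq_jk _.
  have neq_Y : Y j != Y k.
    have [l Hl] := phi_surj (lift s j).
    apply/eqP=> /setP/(_ l); rewrite !inE Hl /= !inE eqxx (inj_eq (@lift_inj _ s)).
    by rewrite (negbTE neq_jk).
  by case: (lacunary _ _ _ neq_Y); rewrite -/(prodg (Y j)) -/(prodg (Y k))
    -/(y j) -/(y k) eq_y; have := prodg_gt0 (Y k); rewrite -/(y k); nia.
have lt_yx i j : (y j < x i)%N.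
  apply: leq_ltn_trans (le_M _ (belowY j)) _; apply: leq_trans (lt_b i) _.
  by rewrite leq_pmull.
exists c, x, y; split=> //.
- move=> i; split; first by rewrite muln_gt0 prodg_gt0 b_gt0.
  rewrite -(Hc (I i)) -/(prodg _); last by apply/set0Pn; exists s; rewrite setU11.
  by rewrite -wE [in RHS]mulnC; apply/same_color/le_M/belowK.
- move=> j; split; first exact: prodg_gt0.
  by rewrite -(Hc [set lift s j]) //; apply/set0Pn; exists (lift s j); rewrite inE.
(* Multiplied by g t, the i-th term of the equation is a_i b^t_i Z. *)
pose Z := (prodg (block_union phi [set s]) * \prod_j y j)%N.
have wQ i : (g t * (prodg (K i) * \prod_(j in F i) y j) = Z)%N.
  rewrite mulnA wE /prodg prod_block_union big_setU1 /=; last first.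
    by apply/imsetP=> -[j _ /eqP]; rewrite (negbTE (neq_lift _ _)).
  rewrite big_imset /=; last by move=> j k _ _; apply: lift_inj.
  rewrite -mulnA; congr muln; rewrite mulnC [RHS](bigID (mem (F i))) /=.
  by congr muln; apply: eq_bigl => j; rewrite inE.
have gt_neq0 : (g t)%:Z != 0 by have := g_gt0 t; lia.
apply: (mulfI gt_neq0); rewrite mulr0 mulr_sumr.
transitivity (Z%:Z * \sum_i a i * (b t i)%:Z); last by rewrite b_zero mulr0.
rewrite mulr_sumr; apply: eq_bigr => i _.
by rewrite -(wQ i) /x !PoszM; ring.
Qed.

Lemma partition_coloring (r : nat) (A : 'I_r -> nat -> Prop) :
  (0 < r)%N -> is_partition A ->
  exists chi : nat -> 'I_r, forall k, (0 < k)%N -> A (chi k) k.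
Proof.
move=> r_gt0 [cover _].
apply: (dependent_function (R := fun k c => (0 < k)%N -> A c k)) => k.
case: (posnP k) => [->|/cover[c Ac]]; first by exists (Ordinal r_gt0).
by exists c.
Qed.

Lemma meval_twisted_poly n m (a : 'I_n -> int) (F : 'I_n -> {set 'I_m})
    (v : 'I_(n + m) -> nat) :
  (twisted_poly a F).@[fun i => (v i)%:Z] =
  \sum_i a i * (v (lshift m i) * \prod_(j in F i) v (rshift n j))%N%:Z.
Proof.
rewrite /twisted_poly raddf_sum /=; apply: eq_bigr => i _.
rewrite mevalZ mevalM /Q rmorph_prod /= mevalXU PoszM; congr (_ * (_ * _)).
rewrite (big_morph Posz PoszM (erefl 1)); apply: eq_bigr => j _.
by rewrite mevalXU.
Qed.

(* The hypothesis [n = 2 -> exists i j, F i != F j] is needed in addition to    *)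
(* the nonemptiness of the union: if F_1 = F_2 = {1}, then                      *)
(* x_1 * y_1 - x_2 * y_1 = 0 forces x_1 = x_2.                                  *)
Theorem theorem3p3 (n : nat) (n_ge2 : (2 <= n)%N)
    (a : 'I_n -> int) (a_neq0 : forall i : 'I_n, a i != 0)
    (R_pr : partition_regular (linear_poly a))
    (m : nat) (m_gt0 : (0 < m)%N)
    (F : 'I_n -> {set 'I_m})
    (F_neq0 : n = 2%N -> \bigcup_(i < n) F i != set0)
    (F_neq : n = 2%N -> exists i j : 'I_n, F i != F j) :
  injectively_partition_regular (twisted_poly a F).
Proof.
move=> r A r_gt0 partA.
have [chi chiA] := partition_coloring r_gt0 partA.
have F_inj (n2 : n = 2%N) := binary_family_injective n2 (F_neq n2).
have [c [x [y [[x_inj y_inj] lt_yx x_col y_col eq0]]]] :=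
  monochromatic_twisted_zero chi n_ge2 a_neq0 (partition_regular_regular R_pr) F_inj.
pose v k := match split k with inl i => x i | inr j => y j end.
have vl i : v (lshift m i) = x i by rewrite /v (unsplitK (inl i)).
have vr j : v (rshift n j) = y j by rewrite /v (unsplitK (inr j)).
exists c, v; split.
- move=> k1 k2; rewrite -[k1]splitK -[k2]splitK.
  case: (split k1) => [i|i]; case: (split k2) => [j|j] /=; rewrite ?vl ?vr.
  + by move/x_inj->.
  + by move=> E; have := lt_yx i j; rewrite E ltnn.
  + by move=> E; have := lt_yx j i; rewrite E ltnn.
  + by move/y_inj->.
- move=> k; rewrite -[k]splitK; case: (split k) => [i|j] /=; rewrite ?vl ?vr.
    by have [x_gt0 <-] := x_col i; apply: chiA.
  by have [y_gt0 <-] := y_col j; apply: chiA.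
rewrite meval_twisted_poly -[RHS]eq0; apply: eq_bigr => i _.
by rewrite vl (eq_bigr y) => [|j _]; last exact: vr.
Qed.
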